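(* Let $I\subset S=K[x_1,\dots,x_n]$ be a monomial ideal with $|G(I)|=m$, where $m$ is even. Suppose there exists a prime ideal $P\in\operatorname{Ass}(S/I)$ with $\operatorname{height}(P)=m$. Then $$\operatorname{sdepth}_S(I)=n-\frac{m}{2}.$$
   Context: $K$ is a field and $S=K[x_1,\dots,x_n]$ is the polynomial ring, with its standard $\mathbb{Z}^n$-grading. $G(I)$ denotes the set of minimal monomial generators of a monomial ideal $I$. Let $M$ be a finitely generated $\mathbb{Z}^n$-graded $S$-module. For a homogeneous $u\in M$ and a subset $Z\subset\{x_1,\dots,x_n\}$, $uK[Z]$ denotes the $K$-subspace of $M$ generated by all $uv$, $v$ a monomial in $K[Z]$; if $uK[Z]$ is a free $K[Z]$-module it is called a Stanley space of dimension $|Z|$. A Stanley decomposition of $M$ is a presentation of $M$ as a finite direct sum of $\mathbb{Z}^n$-graded $K$-vector spaces $\mathcal{D}: M=\bigoplus_{i=1}^{s}u_iK[Z_i]$ with each $u_iK[Z_i]$ a Stanley space; $\operatorname{sdepth}\mathcal{D}=\min_i|Z_i|$, and $\operatorname{sdepth}_S M$ is the maximum of $\operatorname{sdepth}\mathcal{D}$ over all Stanley decompositions $\mathcal{D}$ of $M$. *)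

(* Defs.v *)
From mathcomp Require Import all_boot all_order all_algebra.
From mathcomp Require Import mpoly.

Set Implicit Arguments.
Unset Strict Implicit.
Unset Printing Implicit Defensive.

Import GRing.Theory.
Local Open Scope ring_scope.

(* Subsets of rings and of monomials are Prop-valued predicates, so that       *)
(* ideals and chains of primes range over arbitrary subsets, not only over     *)
(* decidable ones.                                                             *)

Section Ideals.

Variable R : comNzRingType.
Implicit Types (I J P : R -> Prop).

(* Unlike idealr_closed of ring_quotient, the unit ideal is allowed. *)
Definition is_ideal I : Prop :=
  [/\ I 0, forall f g, I f -> I g -> I (f + g) & forall f g, I g -> I (f * g)].

Definition ideal_gen (A : R -> Prop) : R -> Prop :=
  fun f => forall J, is_ideal J -> (forall g, A g -> J g) -> J f.

Definition is_prime_ideal P : Prop :=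
  [/\ is_ideal P, ~ P 1 & forall f g, P (f * g) -> P f \/ P g].

Definition strict_incl I J : Prop :=
  (forall f, I f -> J f) /\ exists2 f, J f & ~ I f.

(* Q 0, ..., Q h is a chain of primes with h strict inclusions, ending at P. *)
Definition prime_chain P (h : nat) (Q : nat -> R -> Prop) : Prop :=
  [/\ forall i, (i <= h)%N -> is_prime_ideal (Q i),
      forall i, (i < h)%N -> strict_incl (Q i) (Q i.+1)
    & forall f, Q h f <-> P f].

Definition has_height P (h : nat) : Prop :=
  (exists Q, prime_chain P h Q) /\
  (forall h' Q, prime_chain P h' Q -> (h' <= h)%N).

(* P is in Ass(R/I): a prime that is the annihilator (I : f) of the class of   *)
(* some f in R/I.                                                              *)
Definition assoc_prime I P : Prop :=
  is_prime_ideal P /\ exists f, forall g, P g <-> I (g * f).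

End Ideals.

Section MonomialIdeals.

Variables (n : nat) (K : fieldType).
Implicit Types (I : {mpoly K[n]} -> Prop).

Definition is_monomial_ideal I : Prop :=
  exists A : 'X_{1..n} -> Prop,
    forall f, I f <-> ideal_gen (fun g => exists2 a, A a & g = 'X_[a]) f.

(* G(I), as exponent vectors: the monomials of I that are minimal for          *)
(* divisibility, i.e. for the componentwise order on exponents.                *)
Definition min_gens I : 'X_{1..n} -> Prop :=
  fun a => I 'X_[a] /\ forall b, I 'X_[b] -> (b <= a)%MM -> b = a.

Definition has_card (T : eqType) (A : T -> Prop) (m : nat) : Prop :=
  exists s : seq T, [/\ uniq s, size s = m & forall a, a \in s <-> A a].

(* The homogeneous elements of S for the Z^n-grading are the terms c x^a. *)
Definition homogeneous (u : {mpoly K[n]}) : Prop :=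
  exists (c : K) (a : 'X_{1..n}), u = c *: 'X_[a].

(* Membership in the polynomial subring K[Z]. *)
Definition in_KZ (Z : {set 'I_n}) (f : {mpoly K[n]}) : Prop :=
  forall a, a \in msupp f -> forall i, i \notin Z -> a i = 0%N.

(* uK[Z]; the K-span of the products u v with v a monomial of K[Z] is the set  *)
(* of all multiples u v with v in K[Z].                                        *)
Definition uKZ (u : {mpoly K[n]}) (Z : {set 'I_n}) : {mpoly K[n]} -> Prop :=
  fun f => exists2 v, in_KZ Z v & f = u * v.

(* uK[Z] is K[Z]-free with basis u. *)
Definition free_on (u : {mpoly K[n]}) (Z : {set 'I_n}) : Prop :=
  forall v, in_KZ Z v -> u * v = 0 -> v = 0.

Record stanley_data := StanleyData {
  st_len : nat;
  st_gen : 'I_st_len -> {mpoly K[n]};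
  st_var : 'I_st_len -> {set 'I_n} }.

(* D is a Stanley decomposition of the graded S-module I. *)
Definition stanley_decomp I (D : stanley_data) : Prop :=
  [/\ forall i, [/\ homogeneous (st_gen i), I (st_gen (s := D) i)
                  & free_on (st_gen i) (st_var i)],
      forall f, I f <-> exists2 w : 'I_(st_len D) -> {mpoly K[n]},
        (forall i, uKZ (st_gen i) (st_var i) (w i)) & f = \sum_i w i
    & forall w : 'I_(st_len D) -> {mpoly K[n]},
        (forall i, uKZ (st_gen i) (st_var i) (w i)) ->
        \sum_i w i = 0 -> forall i, w i = 0].

(* The minimum of the |Z_i|, all of which are at most n. The default n is only *)
(* reached by the empty decomposition, which only the zero module has; so      *)
(* sdepth 0 = n by convention.                                                 *)
Definition sdepth_decomp (D : stanley_data) : nat :=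
  \big[minn/n]_(i < st_len D) #|st_var i|.

Definition has_sdepth I (d : nat) : Prop :=
  (exists2 D, stanley_decomp I D & sdepth_decomp D = d) /\
  (forall D, stanley_decomp I D -> (sdepth_decomp D <= d)%N).

End MonomialIdeals.

(* Main.v *)
From HB Require Import structures.
Require Import Defs.
From mathcomp Require Import all_boot all_order all_algebra.
From mathcomp Require Import mpoly zify ring.

(** The invariant depends only on the set of exponents of the monomials of I:
    a Stanley decomposition of I amounts to a finite partition of that set into
    boxes, the exponent sets of Stanley spaces x^u K[Z], and its Stanley depth
    is the least |Z|.

    Lower bound. Repeat one generator, so as to have an odd number N = m + 1 of
    generators g_0, ..., g_(N-1), and place their indices on a cycle. A monomial
    a of I selects the nonempty set X of the indices i with g_i | a. Read X as a
    cyclic 0-1 word and cut it into tiles 1 and *0, where * is 0 or 1: the cut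
    is unique, since a run of zeros can only be paired from its right end. As N
    is odd there are at most m/2 tiles *0. The a with a given cut are those that
    are divisible by every g_i at a tile 1 and by no g_i at the 0 of a tile *0;
    they are the multiples of a least common multiple, except the multiples of
    at most m/2 monomials. Excluding the multiples of one monomial from a box
    leaves a disjoint union of boxes with at most one free variable less. Hence
    all boxes obtained have dimension at least n - m/2
    ([box_partition_monomial_ideal], [sdepth_lower_bound]).

    Upper bound. Let P = (I : f) and let V be the set of variables in P. Some
    monomial a of f lies outside I, and a x_i lies in I for each i in V. The
    boxes containing the various a x_i are pairwise distinct, for a common box
    would contain a. If j is free in the box of a x_i and i in that of a x_j,
    then a x_i x_j lies in both boxes; so the relation that j is free in the box
    of a x_i contains no 2-cycle on V, and some i has at most (|V| - 1)/2 free
    j in V other than i. This gives 2 sdepth <= 2n - |V| + 1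
    ([sdepth_upper_bound]), and it remains to see that |V| >= m.

    Height. P is spanned by monomials ([annihilator_monomial]), hence generated
    by the variables of V, so the n - |V| other variables are algebraically
    independent modulo P. Going one step down a chain of primes allows one more
    element in an independent family, and no family of more than n polynomials
    in n variables is algebraically independent. So a chain of primes below P
    has at most |V| steps ([prime_chain_monomial]), and m = height P <= |V|. *)

Set Implicit Arguments.
Unset Strict Implicit.
Unset Printing Implicit Defensive.

Import GRing.Theory.

(** * Cutting cyclic words of odd length into tiles *)

Section CyclicParsing.

Variable N : nat.
Implicit Types (T X : {set 'I_N}) (i j : 'I_N).

(** The cut of the cyclic word X into tiles 1 and *0 is encoded by the set T of
    the positions of the stars: i starts a tile *0 exactly when position i + 1
    is a zero which does not itself start a tile. *)
Definition parses T X : bool :=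
  [forall i, (i \in T) == (ordS i \notin X) && (ordS i \notin T)].

Lemma parsesP T X :
  reflect (forall i, (i \in T) = (ordS i \notin X) && (ordS i \notin T))
          (parses T X).
Proof. by apply: (iffP forallP) => h i; apply/eqP. Qed.

Lemma iter_ordS t i : iter t (@ordS N) i = (i + t) %% N :> nat.
Proof.
elim: t => [|t IHt] /=; first by rewrite addn0 modn_small.
by rewrite IHt -addn1 modnDml addn1 addnS.
Qed.

Lemma ordS_transitive i j : exists t, iter t.+1 (@ordS N) i = j.
Proof.
have iN := ltn_ord i; exists (N - i + j).-1; apply: ord_inj.
rewrite iter_ordS -[RHS](modn_small (ltn_ord j)).
have ->: i + (N - i + j).-1.+1 = N + j by have := ltn_ord j; lia.
exact: modnDl.
Qed.

(** The stars are the positions followed by an odd number of consecutive zeros;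
    the next element of X, which exists as X is nonempty, ends the count. *)
Lemma parses_exists X : X != set0 -> exists T, parses T X.
Proof.
case/set0Pn => j jX.
have gapX i : exists t, iter t.+1 (@ordS N) i \in X.
  by have [t tj] := ordS_transitive i j; exists t; rewrite tj.
exists [set i | odd (ex_minn (gapX i))]; apply/parsesP => i; rewrite !inE.
case: ex_minnP => t tX tmin; case: ex_minnP => t' t'X t'min.
have [iX|iX] := boolP (ordS i \in X).
  by have := tmin 0 iX; rewrite leqn0 => /eqP ->.
case: t tX tmin => [|t] tX tmin; first by rewrite tX in iX.
have ->: t' = t; last by [].
apply/eqP; rewrite eqn_leq t'min /=; last by rewrite -iterSr.
by have := tmin t'.+1; rewrite iterSr => /(_ t'X).
Qed.

(** A star at i is determined by X and by the presence of a star at i + 1, and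
    there is none just before an element of X; so the cut is determined from
    right to left. *)
Lemma parses_uniq X T T' : X != set0 -> parses T X -> parses T' X -> T = T'.
Proof.
case/set0Pn => j jX /parsesP TX /parsesP T'X; apply/setP => i.
have [t] := ordS_transitive i j.
elim: t i => [|t IHt] i ij.
  by rewrite TX T'X -[ordS i]/(iter 1 _ i) ij jX.
by rewrite TX T'X (IHt (ordS i)) // -iterSr.
Qed.

(** In a word without ones, each position is a star or the zero of a tile *0,
    and these alternate: that is impossible on an odd cycle. *)
Lemma parses_set0 T : odd N -> ~~ parses T set0.
Proof.
move=> oddN; apply/negP => /parsesP T0.
have defT : ~: T = @ordS N @^-1: T.
  by apply/setP => i; rewrite in_setC T0 in_set0 /= negbK inE.
have := cardsC T; rewrite defT on_card_preimset ?card_ord; last first.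
  by apply: onW_bij; exists (@ord_pred N); [exact: ordSK | exact: ord_predK].
by move=> eN; move: oddN; rewrite -eN oddD addbb.
Qed.

(** Independence of T in the cycle graph: tiles do not overlap. *)
Definition stable T : bool := [forall i in T, ordS i \notin T].

Lemma parses_stable T X : parses T X -> stable T.
Proof.
move=> /parsesP TX; apply/forall_inP => i iT.
by have /esym := TX i; rewrite iT => /andP[].
Qed.

Lemma stable_card T : stable T -> #|T| <= N./2.
Proof.
move=> /forall_inP sT; rewrite -[leqLHS]doubleK half_leq // -addnn.
rewrite -{2}(card_imset _ (can_inj (@ordSK N))) -[leqRHS]card_ord.
rewrite -cardsUI (_ : T :&: _ = set0) ?cards0 ?addn0 ?max_card //.
apply/eqP; apply: contraT => /set0Pn [j] /setIP [jT /imsetP [i iT ji]].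
by have := sT i iT; rewrite -ji jT.
Qed.

(** The sets with a given cut form an interval: they contain the positions of
    the tiles 1, avoid the zeros of the tiles *0 and are arbitrary on the stars.
    *)
Lemma parsesE T X : stable T ->
  parses T X = [forall i, (i \notin T) && (ordS i \notin T) ==> (ordS i \in X)]
               && [forall i in T, ordS i \notin X].
Proof.
move=> /forall_inP sT.
apply/parsesP/andP => [TX|[/forallP TX /forall_inP XT] i].
  split; last first.
    apply/forall_inP => i iT.
    by have /esym := TX i; rewrite iT => /andP[].
  apply/forallP => i; have := TX i.
  by do 3 case: (_ \in _).
have [iT|iT] := boolP (i \in T); first by rewrite XT // sT.
have := TX i; rewrite iT /=; have [//|siT] := boolP (ordS i \in T).
  by rewrite andbF.
by move=> /= ->.
Qed.

End CyclicParsing.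

(** * Partitions of sets of exponents into boxes *)

Section Boxes.

Variable n : nat.
Implicit Types (E F : pred 'X_{1..n}) (Z : {set 'I_n}).
Implicit Types (a b h u : 'X_{1..n}) (d : nat).

Local Notation box := ('X_{1..n} * {set 'I_n})%type.

(** The exponents of the monomials of the Stanley space x^u K[Z]. *)
Definition in_box (B : box) a : bool :=
  [forall i, if i \in B.2 then B.1 i <= a i else a i == B.1 i].

Lemma in_boxP u Z a :
  reflect (forall i, if i \in Z then u i <= a i else a i == u i)
          (in_box (u, Z) a).
Proof. exact: forallP. Qed.

(** Counting the boxes that contain a says at once that they cover E, lie in E
    and are pairwise disjoint. *)
Definition box_partition d E : Prop :=
  exists2 L : seq box,
    all (fun B : box => d <= #|B.2|) L & forall a, count (in_box^~ a) L = E a.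

Lemma box_partition_eq d E F : E =1 F -> box_partition d E -> box_partition d F.
Proof. by move=> EF [L Ld LE]; exists L => // a; rewrite LE EF. Qed.

Lemma box_partition0 d : box_partition d xpred0.
Proof. by exists [::]. Qed.

Lemma box_partition1 d u Z : d <= #|Z| -> box_partition d (in_box (u, Z)).
Proof. by move=> dZ; exists [:: (u, Z)] => [|a] /=; rewrite ?dZ ?addn0. Qed.

Lemma box_partition_sum (T : eqType) (r : seq T) d
    (E_ : T -> pred 'X_{1..n}) E :
    {in r, forall t, box_partition d (E_ t)} ->
    (forall a, \sum_(t <- r) E_ t a = E a) ->
  box_partition d E.
Proof.
move=> E_part sumE.
suff [L Ld LE] : exists2 L : seq box,
    all (fun B : box => d <= #|B.2|) L
  & forall a, count (in_box^~ a) L = \sum_(t <- r) E_ t a.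
  by exists L => // a; rewrite LE sumE.
elim: r E_part {sumE} => [|t r IHr] E_part.
  by exists [::] => // a; rewrite big_nil.
have [L Ld LE] := E_part t (mem_head t r).
have [s sr|L' L'd L'E] := IHr; first by apply: E_part; rewrite inE sr orbT.
by exists (L ++ L') => [|a]; rewrite ?all_cat ?Ld // count_cat LE L'E big_cons.
Qed.

(** If h does not divide x^u, some exponent u_i is less than h_i. For i outside
    Z the whole box is kept. For i in Z, the slice a_i = u_i of the box has one
    free variable less and contains no multiple of h; the rest of the box starts
    at u + U_(i), which is closer to h. *)
Lemma box_minus_multiples h u Z :
  box_partition #|Z|.-1 (fun a => in_box (u, Z) a && ~~ (h <= a)%MM).
Proof.
have [k] := ubnP (mdeg (h - u)%MM); elim: k u => // k IHk u.
rewrite ltnS => le_k.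
have [le_hu|/forallPn [i]] := boolP [forall i, h i <= u i].
  apply: box_partition_eq (box_partition0 _) => a.
  apply/esym/negbTE; rewrite negb_and negbK orbC.
  case: in_boxP => ua /=; last by rewrite orbT.
  rewrite orbF; apply/mnm_lepP => i; apply: leq_trans (forallP le_hu i) _.
  by have := ua i; case: ifP => // _ /eqP ->.
rewrite -ltnNge => lt_ui; have [iZ|iZ] := boolP (i \in Z); last first.
  apply: (@box_partition_eq _ (in_box (u, Z))); last first.
    exact/box_partition1/leq_pred.
  move=> a; rewrite andb_idr // => /in_boxP /(_ i).
  rewrite (negbTE iZ) => /eqP ai.
  by apply/negP => /mnm_lepP /(_ i); rewrite ai leqNgt lt_ui.
have [//|L Ld LE] := IHk (u + U_(i))%MM.
  apply: leq_trans le_k; rewrite !mdegE (bigD1 i) //= [leqRHS](bigD1 i) //=.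
  rewrite !mnmBE mnmDE mnm1E eqxx -addSn leq_add //; first lia.
  apply: leq_sum => j ji.
  by rewrite !mnmBE mnmDE mnm1E eq_sym (negbTE ji) addn0.
exists ((u, Z :\ i) :: L) => [|a] /=.
  by rewrite Ld andbT (cardsD1 i Z) iZ.
rewrite LE.
have box_i : in_box (u, Z :\ i) a = in_box (u, Z) a && (a i == u i).
  apply/in_boxP/andP => [ua|[/in_boxP ua ai] j].
    split; last by have := ua i; rewrite !inE eqxx.
    apply/in_boxP => j; have := ua j; rewrite !inE.
    by have [->|] //= := eqVneq j i; rewrite iZ => /eqP ->.
  by have := ua j; rewrite !inE; have [->|] //= := eqVneq j i.
have box_Si : in_box ((u + U_(i))%MM, Z) a = in_box (u, Z) a && (u i < a i).
  apply/in_boxP/andP => [ua|[/in_boxP ua ai] j].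
    split; last by have := ua i; rewrite iZ mnmDE mnm1E eqxx addn1.
    apply/in_boxP => j; have := ua j; rewrite mnmDE mnm1E.
    have [<-|_] := eqVneq i j; last by rewrite addn0.
    by rewrite iZ => /(leq_trans (leq_addr _ _)).
  have := ua j; rewrite mnmDE mnm1E.
  have [<-|_] := eqVneq i j; last by rewrite addn0.
  by rewrite iZ addn1.
rewrite box_i box_Si; case: in_boxP => //= ua.
have := ua i; rewrite iZ leq_eqVlt eq_sym; case: eqVneq => /= [ai _ | _ ->] //.
have -> : (h <= a)%MM = false; last by rewrite ai ltnn.
by apply/negP => /mnm_lepP /(_ i); rewrite ai leqNgt lt_ui.
Qed.

Lemma box_partition_minus d E h :
  box_partition d E -> box_partition d.-1 (fun a => E a && ~~ (h <= a)%MM).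
Proof.
case=> L Ld LE.
apply: (@box_partition_sum _ L _
  (fun B a => in_box B a && ~~ (h <= a)%MM)) => [[u Z] uZ | a].
  have [L' L'd L'E] := box_minus_multiples h u Z; exists L' => //.
  apply: sub_all L'd => B; apply: leq_trans.
  by have /= := allP Ld _ uZ; lia.
rewrite [X in _ = nat_of_bool X]andbC -mulnb -LE -sum1_count.
rewrite [in RHS]big_mkcond /=.
by rewrite big_distrr /=; apply: eq_bigr => B _; case: in_box; case: (~~ _).
Qed.

Lemma box_partition_minus_seq d E (hs : seq 'X_{1..n}) :
    box_partition d E ->
  box_partition (d - size hs)
    (fun a => E a && all (fun h => ~~ (h <= a)%MM) hs).
Proof.
elim: hs => [|h hs IHhs] Ed /=.
  by rewrite subn0; apply: box_partition_eq Ed => a; rewrite andbT.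
have := box_partition_minus h (IHhs Ed); rewrite -subnS.
by apply: box_partition_eq => a; rewrite -andbA; congr (_ && _); rewrite andbC.
Qed.

Lemma box_partition_multiples (I : finType) (A : {set I}) (g : I -> 'X_{1..n}) :
  box_partition n (fun a => [forall j in A, (g j <= a)%MM]).
Proof.
(* x^u is the least common multiple of the x^(g j). *)
pose u : 'X_{1..n} := [multinom \max_(j in A) g j i | i < n].
have : box_partition n (in_box (u, setT)).
  by apply: box_partition1; rewrite cardsT card_ord.
apply: box_partition_eq => a; apply/in_boxP/forall_inP => [ua j jA | ga i].
  apply/mnm_lepP => i; have := ua i; rewrite inE mnmE; apply: leq_trans.
  exact: (@leq_bigmax_cond _ (mem A) (fun j => g j i)).
by rewrite inE mnmE; apply/bigmax_leqP => j jA; have /mnm_lepP := ga j jA.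
Qed.

End Boxes.

(** The monomials of the ideal are sorted by the cut T of the set of the indices
    of the generators that divide them. *)
Lemma box_partition_monomial_ideal n N (g : 'I_N -> 'X_{1..n}) : odd N ->
  box_partition (n - N./2) (fun a => [exists j, (g j <= a)%MM]).
Proof.
move=> oddN; pose X a := [set j | (g j <= a)%MM].
pose E_ T a := parses T (X a).
apply: (@box_partition_sum _ _ (enum [set T | stable T]) _ E_) => [T | a].
  rewrite mem_enum inE => sT.
  (* A is the set of the positions of the tiles 1. *)
  pose A := [set j |
    [exists i, [&& j == ordS i, i \notin T & ordS i \notin T]]].
  have [L Ld LE] := box_partition_minus_seq [seq g (ordS i) | i in T]
    (box_partition_multiples A g).
  exists L => [|a].
    apply: sub_all Ld => B; apply: leq_trans.
    by rewrite size_map -cardE leq_sub2l // stable_card.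
  rewrite LE /E_ parsesE //; congr (nat_of_bool (_ && _)).
    apply/forall_inP/forallP => [Aa i | TX j].
      apply/implyP => /andP[iT siT]; rewrite inE Aa // inE.
      by apply/existsP; exists i; rewrite eqxx iT.
    rewrite inE => /existsP [i /and3P [/eqP -> iT siT]].
    by have := TX i; rewrite iT siT inE.
  rewrite all_map -[RHS]big_andE -big_enum big_all.
  by apply: eq_all => i; rewrite /= inE.
rewrite big_enum /=; have [X0|X0] := eqVneq (X a) set0.
  have -> : [exists j, (g j <= a)%MM] = false.
    by apply/existsP => [[j ja]]; have := in_set0 j; rewrite -X0 inE ja.
  by rewrite big1 // => T _; rewrite /E_ X0 (negbTE (parses_set0 T oddN)).
have -> : [exists j, (g j <= a)%MM].
  by case/set0Pn: X0 => j; rewrite inE => ja; apply/existsP; exists j.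
have [T TX] := parses_exists X0.
rewrite (bigD1 T) /=; last by rewrite inE (parses_stable TX).
rewrite /E_ TX big1 // => T' /andP[_ T'T]; apply/eqP; rewrite eqb0.
by apply: contra T'T => T'X; rewrite (parses_uniq X0 T'X TX).
Qed.

(** * Stanley decompositions of monomial ideals are box partitions *)

Section StanleyBoxes.

Variables (n : nat) (K : fieldType).
Implicit Types (I : {mpoly K[n]} -> Prop) (E : pred 'X_{1..n}).
Implicit Types (f g : {mpoly K[n]}) (a b u : 'X_{1..n}) (Z : {set 'I_n}).

Local Open Scope ring_scope.

Lemma ideal_sum I (T : Type) (r : seq T) (P : pred T) (F : T -> {mpoly K[n]}) :
  is_ideal I -> (forall t, P t -> I (F t)) -> I (\sum_(t <- r | P t) F t).
Proof. by case=> I0 ID _ IF; elim/big_ind: _. Qed.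

Lemma idealZ I c f : is_ideal I -> I f -> I (c *: f).
Proof. by case=> _ _ IM If; rewrite -mul_mpolyC; apply: IM. Qed.

Lemma monomial_ideal_is_ideal I : is_monomial_ideal I -> is_ideal I.
Proof.
case=> A IA; split=> [|f g /IA If /IA Ig|f g /IA Ig].
- by apply/IA => J [].
- apply/IA => J Jideal AJ; case: (Jideal) => _ JD _.
  by apply: JD; [exact: If | exact: Ig].
- apply/IA => J Jideal AJ; case: (Jideal) => _ _ JM.
  by apply: JM; exact: Ig.
Qed.

(** The polynomials all of whose terms are multiples of the generators form an
    ideal containing the generators. *)
Lemma monomial_ideal_msupp I f : is_monomial_ideal I ->
  I f <-> {in msupp f, forall a, I 'X_[a]}.
Proof.
move=> Imon; have Iideal := monomial_ideal_is_ideal Imon.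
case: Imon => A IA; split=> [/IA If a af | If]; last first.
  rewrite [f]mpolyE big_seq; apply: ideal_sum => // a af.
  by apply: idealZ => //; apply: If.
pose J g := {in msupp g, forall a, exists2 b, A b & (b <= a)%MM}.
have [||b Ab ba] := If J _ _ a af.
- split=> [b|f1 f2 J1 J2 b|f1 f2 J2 b].
  + by rewrite msupp0.
  + by move/msuppD_le; rewrite mem_cat => /orP[/J1|/J2].
  + move/msuppM_le => /allpairsP [[b1 b2] /= [_ /J2 [c Ac cb] ->]].
    by exists c => //; apply: lepm_trans cb (lem_addl _ _).
- move=> _ [b Ab ->] c; rewrite msuppX inE => /eqP ->.
  by exists b; rewrite ?lepm_refl.
rewrite -(submK ba) mpolyXD; case: (Iideal) => _ _; apply; apply/IA => J' _.
by apply; exists b.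
Qed.

(** Induction on the degree. If no element of s divides a, then by induction a
    has no proper divisor in I, so that a is itself a minimal generator; only
    the decidable divisibility by s is argued by contradiction, not membership
    in I. *)
Lemma min_gens_dvd I (s : seq 'X_{1..n}) a : is_ideal I ->
    (forall b, b \in s <-> min_gens I b) ->
  I 'X_[a] <-> has (fun b => (b <= a)%MM) s.
Proof.
move=> Iideal sI; split=> [|/hasP [b /sI [Ib _] ba]]; last first.
  by rewrite -(submK ba) mpolyXD; case: (Iideal) => _ _; apply.
have [k] := ubnP (mdeg a); elim: k a => // k IHk a; rewrite ltnS => ak Ia.
apply: contraT => Na; have /sI a_s : min_gens I a.
  split=> // b Ib ba; apply/eqP; apply: contraNT Na => b_a.
  have /hasP [c c_s cb] : has (fun c => (c <= b)%MM) s.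
    apply: IHk Ib; apply: leq_trans ak.
    rewrite -(submK ba) mdegD -[ltnLHS]add0n ltn_add2r lt0n mdeg_eq0.
    by apply: contra b_a => /eqP a_b; rewrite -(submK ba) a_b add0m.
  by apply/hasP; exists c => //; apply: lepm_trans cb ba.
by case/hasP: Na; exists a; rewrite ?lepm_refl.
Qed.

Lemma monomial_ideal_gens I m :
    is_monomial_ideal I -> has_card (min_gens I) m ->
  exists2 s : seq 'X_{1..n}, size s = m
    & forall f, I f <-> all (fun a => has (fun b => (b <= a)%MM) s) (msupp f).
Proof.
move=> Imon [s [_ sz_s sI]]; exists s => // f.
have Iideal := monomial_ideal_is_ideal Imon.
rewrite monomial_ideal_msupp //.
split=> [If|/allP If a af]; last by apply/(min_gens_dvd a Iideal sI)/If.
by apply/allP => a af; apply/(min_gens_dvd a Iideal sI)/If.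
Qed.

Lemma uKZ_box (c : K) u Z f : c != 0 ->
  uKZ (c *: 'X_[u]) Z f <-> {in msupp f, forall a, in_box (u, Z) a}.
Proof.
move=> c0; split=> [[v vZ ->] a|f_box].
  rewrite -scalerAl (perm_mem (msuppZ _ c0)) mulrC (perm_mem (msuppMX _ _)).
  case/mapP => b bv ->; apply/in_boxP => i; rewrite mnmDE.
  by have [_|iZ] := boolP (i \in Z); rewrite ?leq_addr // (vZ b bv i iZ) addn0.
have ule a : a \in msupp f -> (u <= a)%MM.
  move=> /f_box/in_boxP ua; apply/mnm_lepP => i.
  by have := ua i; case: ifP => // _ /eqP ->.
exists (\sum_(a <- msupp f) (c^-1 * f@_a) *: 'X_[a - u]).
  move=> b /(msupp_sum_le (P := predT)) /flatten_mapP [a].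
  rewrite filter_predT => af /msuppZ_le; rewrite msuppX inE => /eqP -> i iZ.
  have := f_box a af => /in_boxP /(_ i); rewrite (negbTE iZ) => /eqP.
  by rewrite mnmBE => ->; rewrite subnn.
rewrite [LHS]mpolyE big_distrr /= big_seq [RHS]big_seq; apply: eq_bigr => a af.
rewrite -scalerAl -scalerAr scalerA mulrA mulfV // mul1r -mpolyXD addmC.
by rewrite submK // ule.
Qed.

Lemma in_box_self u Z : in_box (u, Z) u.
Proof. by apply/in_boxP => i; case: ifP. Qed.

Lemma sdepth_decomp_le (D : stanley_data n K) i :
  (sdepth_decomp D <= #|st_var (s:=D) i|)%N.
Proof.
have := mem_index_enum i; rewrite /sdepth_decomp.
elim: (index_enum _) => // j r IHr; rewrite inE big_cons geq_min.
by case/predU1P => [<-|/IHr ->]; rewrite ?leqnn ?orbT.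
Qed.

Lemma sdepth_decomp_le_n (D : stanley_data n K) : (sdepth_decomp D <= n)%N.
Proof.
apply: (big_ind (leq^~ n)) => // [x y xn _|i _]; first by rewrite geq_min xn.
by rewrite -[leqRHS]card_ord max_card.
Qed.

(** A polynomial of I is the sum of its parts supported in each box, and the
    coefficient of x^a in a sum of elements of the Stanley spaces is that of the
    only summand whose box contains a. *)
Lemma stanley_decomp_of_boxes I E d :
    (forall f, I f <-> all E (msupp f)) -> box_partition d E -> (d <= n)%N ->
  exists2 D, stanley_decomp I D & (d <= sdepth_decomp D)%N.
Proof.
move=> IE [L Ld LE] dn; pose B i := tnth (in_tuple L) i.
pose D := @StanleyData n K (size L) (fun i => 'X_[(B i).1]) (fun i => (B i).2).
have spaceP i f : uKZ (st_gen (s := D) i) (st_var i) f <->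
    {in msupp f, forall a, in_box (B i) a}.
  have := @uKZ_box 1 (B i).1 (B i).2 f (oner_neq0 _).
  by rewrite scale1r -surjective_pairing.
have countE a : (\sum_(i < size L) in_box (B i) a = E a)%N.
  by rewrite -LE -sum1_count [RHS]big_mkcond [RHS]big_tnth.
have box_E i a : in_box (B i) a -> E a.
  by move=> ia; have := countE a; rewrite (bigD1 i) //= ia; case: (E a).
have box_inj i j a : in_box (B i) a -> in_box (B j) a -> i = j.
  move=> ia ja; apply/eqP; apply: contraT => ij.
  have := countE a; rewrite (bigD1 i) //= ia.
  rewrite (bigD1 j) /=; last by rewrite eq_sym.
  by rewrite ja; case: (E a).
have E_box a : E a -> exists i, in_box (B i) a.
  move=> Ea; apply/existsP; apply: contraT; rewrite negb_exists => /forallP N.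
  by have := countE a; rewrite Ea big1 // => i _; rewrite (negbTE (N i)).
have mcoeff_space w a i :
    (forall j, uKZ (st_gen (s := D) j) (st_var j) (w j)) -> in_box (B i) a ->
    (\sum_j w j)@_a = (w i)@_a.
  move=> wP ia; rewrite raddf_sum (bigD1 i) //= big1 ?addr0 // => j ji.
  apply: memN_msupp_eq0; apply: contra ji => aj.
  by rewrite (box_inj j i a) //; have /spaceP := wP j; apply.
exists D; last first.
  apply: (big_ind (leq d)) => // [x y dx dy|i _]; first by rewrite leq_min dx.
  by apply: (allP Ld); apply: mem_tnth.
split=> [i|f|w wP w0 i].
- split.
  + by exists 1, (B i).1; rewrite scale1r.
  + apply/IE; rewrite msuppX /= andbT (box_E i) // [B i]surjective_pairing.
    exact: in_box_self.
  + by move=> v _ /eqP; rewrite mulf_eq0 -msupp_eq0 msuppX => /eqP.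
- split=> [/IE/allP Ef|[w wP ->]]; last first.
    apply/IE/allP => a /(msupp_sum_le (P := predT)) /flatten_mapP [i _].
    by move=> aw; apply: (box_E i); have /spaceP := wP i; apply.
  exists (fun i => \sum_(a <- msupp f | in_box (B i) a) f@_a *: 'X_[a]).
    move=> i; apply/spaceP => a /msupp_sum_le /flatten_mapP [b].
    rewrite mem_filter => /andP[ib _] /msuppZ_le.
    by rewrite msuppX inE => /eqP ->.
  rewrite [LHS]mpolyE (exchange_big_dep predT) //= big_seq [RHS]big_seq.
  apply: eq_bigr => a af; have [i ia] := E_box a (Ef a af).
  rewrite (big_pred1 i) // => j.
  by apply/idP/eqP => [ja|->//]; apply: box_inj ja ia.
- apply/mpolyP => a; rewrite mcoeff0.
  have [aw|/memN_msupp_eq0 //] := boolP (a \in msupp (w i)).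
  rewrite -(mcoeff_space w) ?w0 ?mcoeff0 //.
  by have /spaceP := wP i; apply.
Qed.

(** If x^a lay in two Stanley spaces, x^a - x^a = 0 would be a second
    decomposition of 0. *)
Lemma stanley_decomp_boxes I D : is_ideal I -> stanley_decomp I D ->
  exists u : 'I_(st_len D) -> 'X_{1..n},
  [/\ forall i a, in_box (u i, st_var i) a -> I 'X_[a],
      forall a, I 'X_[a] -> exists i, in_box (u i, st_var i) a
    & forall a i j, in_box (u i, st_var i) a -> in_box (u j, st_var j) a ->
        i = j].
Proof.
move=> Iideal [genP sumP uniqP].
have [u uP] : exists u : 'I_(st_len D) -> 'X_{1..n}, forall i, exists2 c,
    c != 0 & st_gen i = c *: 'X_[u i].
  apply: (fin_all_exists (P := fun i u => exists2 c,
    c != 0 & st_gen i = c *: 'X_[u])) => i.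
  have [[c [u gi]] _ gfree] := genP i.
  exists u; exists c => //; apply/eqP => c0.
  have /eqP : (1 : {mpoly K[n]}) = 0; last by rewrite oner_eq0.
  apply: (gfree 1); last by rewrite gi c0 scale0r mul0r.
  move=> a; rewrite -[1]/(1%:MP) msupp1 inE => /eqP -> j _.
  by rewrite mnm0E.
have spaceP i f : uKZ (st_gen i) (st_var i) f <->
    forall a, a \in msupp f -> in_box (u i, st_var i) a.
  by have [c c0 ->] := uP i; apply: uKZ_box.
have space0 (i : 'I_(st_len D)) : uKZ (st_gen i) (st_var i) 0.
  by apply/spaceP => a; rewrite msupp0.
have Xspace i a : in_box (u i, st_var i) a -> uKZ (st_gen i) (st_var i) 'X_[a].
  by move=> ia; apply/spaceP => b; rewrite msuppX inE => /eqP ->.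
exists u; split=> [i a ia|a|a i j ia ja].
- apply/sumP; exists (fun j => if j == i then 'X_[a] else 0).
    by move=> j; case: eqP => [->|_] //; apply: Xspace.
  by rewrite -big_mkcond big_pred1_eq.
- move=> /sumP [w wP aw].
  have : a \in msupp (\sum_i w i) by rewrite -aw msuppX inE.
  move=> /(msupp_sum_le (P := predT)) /flatten_mapP [i _ ai]; exists i.
  by have /spaceP := wP i; apply.
- have [//|ij] := eqVneq i j.
  pose w k : {mpoly K[n]} :=
    if k == i then 'X_[a] else if k == j then - 'X_[a] else 0.
  have : w i = 0.
    apply: uniqP.
      move=> k; rewrite /w; case: eqP => [->|_]; first exact: Xspace.
      case: eqP => [->|_] //; apply/spaceP => b.
      by rewrite (perm_mem (msuppN _)) msuppX inE => /eqP ->.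
    rewrite (bigD1 i) //= (bigD1 j) /=; last by rewrite eq_sym.
    rewrite big1 => [|k /andP[ki kj]]; last first.
      by rewrite /w (negbTE ki) (negbTE kj).
    by rewrite /w !eqxx eq_sym (negbTE ij) addr0 subrr.
  by move/eqP; rewrite /w eqxx -msupp_eq0 msuppX.
Qed.

End StanleyBoxes.

(** * The upper bound, and annihilators modulo monomial ideals *)

Section UpperBound.

Variables (n : nat) (K : fieldType) (I : {mpoly K[n]} -> Prop).
Variables (E : pred 'X_{1..n}).
Implicit Types (f g : {mpoly K[n]}) (a : 'X_{1..n}).

Local Open Scope ring_scope.

(** Double counting over V of the pairs i, j such that j is free in the box of
    x_i x^a. Each i contributes at least sdepth D - (n - |V|) - 1 elements j of
    V other than i, and each unordered pair contributes at most once. *)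
Lemma sdepth_upper_bound D a (V : {set 'I_n}) :
    is_ideal I -> stanley_decomp I D -> ~ I 'X_[a] ->
    {in V, forall i, I 'X_[a + U_(i)]} -> V != set0 ->
  ((sdepth_decomp D).*2 + #|V| <= n.*2.+1)%N.
Proof.
move=> Iideal stD NIa IaV V0.
have [u [box_I I_box box_inj]] := stanley_decomp_boxes Iideal stD.
have [k kP] : exists k : 'I_n -> 'I_(st_len D), forall i,
    i \in V -> in_box (u (k i), st_var (k i)) (a + U_(i))%MM.
  apply: (fin_all_exists (P := fun i (k : 'I_(st_len D)) =>
    i \in V -> in_box (u k, st_var k) (a + U_(i))%MM)) => i.
  have [iV|iV] := boolP (i \in V).
    by have [k ik] := I_box _ (IaV i iV); exists k.
  by case/set0Pn: V0 => j jV; have [k _] := I_box _ (IaV j jV); exists k.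
(* A box that contains a + U_(i) and a + U_(j) contains their meet a. *)
have k_inj : {in V &, injective k}.
  move=> i j iV jV kij; apply/eqP; apply: contraT => ij; case: NIa.
  apply: (box_I (k i)); apply/in_boxP => l.
  have /in_boxP/(_ l) := kP i iV; have /in_boxP/(_ l) := kP j jV.
  rewrite -kij !mnmDE !mnm1E.
  have [<-|_] := eqVneq i l; last by rewrite addn0.
  by rewrite [j == i]eq_sym (negbTE ij) addn0; case: ifP => // _ /eqP <-.
pose e i j := (j != i) && (j \in st_var (k i)).
have e_asym i j : i \in V -> j \in V -> (e i j + e j i <= (j != i))%N.
  move=> iV jV; rewrite /e eq_sym; have [//|ij] /= := eqVneq i j.
  case ji: (j \in _); case ij': (i \in _) => //=.
  case/eqP: ij; apply: k_inj => //.
  apply: (box_inj (a + U_(i) + U_(j))%MM); apply/in_boxP => l.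
    have /in_boxP/(_ l) := kP i iV; rewrite [in X in _ -> X]mnmDE mnm1E.
    have [<-|_] := eqVneq j l; last by rewrite addn0.
    by rewrite ji => /leq_trans; apply; apply: leq_addr.
  have /in_boxP/(_ l) := kP j jV.
  rewrite -addmA (addmC U_(i)%MM) addmA [in X in _ -> X]mnmDE mnm1E.
  have [<-|_] := eqVneq i l; last by rewrite addn0.
  by rewrite ij' => /leq_trans; apply; apply: leq_addr.
have sum_e : ((\sum_(i in V) \sum_(j in V) e i j).*2 <= #|V| * #|V|.-1)%N.
  rewrite -addnn {2}exchange_big -big_split /=.
  rewrite -sum_nat_const; apply: leq_sum => i iV.
  rewrite -big_split /=.
  apply: (leq_trans (leq_sum _ (E2 := fun j => (j != i) : nat) _)).
    by move=> j jV; apply: e_asym.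
  rewrite (bigD1 i) //= eqxx add0n (cardsD1 i V) iV /= -sum1_card.
  rewrite [leqRHS](eq_bigl (fun j => (j \in V) && (j != i))).
    by apply: leq_sum => j /andP[_ ->].
  by move=> j; rewrite !inE andbC.
have out_e i : i \in V ->
    (sdepth_decomp D + #|V| <= n + (\sum_(j in V) e i j).+1)%N.
  move=> iV; apply: leq_trans (leq_add (sdepth_decomp_le (k i)) (leqnn _)) _.
  rewrite -cardsUI leq_add //; first by rewrite -[leqRHS]card_ord max_card.
  rewrite (cardsD1 i) -add1n leq_add ?leq_b1 // -sum1_card.
  rewrite [leqRHS]big_mkcond [leqLHS]big_mkcond /=; apply: leq_sum => j _.
  by rewrite !inE /e; case: (j \in V); case: (j != i); case: (j \in _).
have : (#|V| * (sdepth_decomp D + #|V|) <=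
        #|V| * n.+1 + \sum_(i in V) \sum_(j in V) e i j)%N.
  rewrite -!sum_nat_const -big_split /=; apply: leq_sum => i iV.
  by have := out_e i iV; rewrite addnS addSn.
move: sum_e; move: (\sum_(i in V) _)%N => s; move: V0; rewrite -card_gt0.
move: (sdepth_decomp D) => d.
case: #|V| => // v _ /= hs hd; rewrite -(leq_pmul2l (ltn0Sn v)); nia.
Qed.

Hypothesis IE : forall f, I f <-> all E (msupp f).

(** Let w be the leading monomial of g and let c be that of the part of f
    outside I. As g f is in I, so is w c, and hence w f has fewer terms outside
    I than f. If w is not in P then (I : w f) = (P : w) = P, so that f can be
    replaced with w f. *)
Lemma annihilator_mlead P f g : is_ideal I -> is_prime_ideal P ->
    (forall h, P h <-> I (h * f)) -> P g -> g != 0 -> P 'X_[mlead g].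
Proof.
move=> Iideal [[_ _ PM] NP1 Pprime].
have EX a : E a <-> I 'X_[a] by rewrite IE msuppX /= andbT.
have Eup a b : E b -> E (a + b)%MM.
  by rewrite !EX mpolyXD => Ib; case: Iideal => _ _; apply.
have [k] := ubnP (count (predC E) (msupp f)); elim: k f => // k IHk f.
rewrite ltnS => f_le Pf Pg g0; pose w := mlead g.
have [Ewf|NEwf] := boolP (all E (msupp ('X_[w] * f))); first exact/Pf/IE.
have NPw : ~ P 'X_[w] by move=> /Pf/IE; rewrite (negbTE NEwf).
apply: (IHk ('X_[w] * f)) => // [|h]; last first.
  rewrite mulrA -Pf; split=> [Ph|/Pprime[]//].
  by rewrite mulrC; apply: PM.
(* f' is the part of f outside I. *)
pose f' := \sum_(a <- msupp f | ~~ E a) f@_a *: 'X_[a].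
have f'E a : f'@_a = if E a then 0 else f@_a.
  rewrite raddf_sum /=; under eq_bigr do rewrite mcoeffZ mcoeffX.
  have [af|/memN_msupp_eq0 fa0] := boolP (a \in msupp f); last first.
    rewrite fa0 if_same big1_seq // => b /andP[_ bf].
    by have [->|] := eqVneq b a; rewrite ?fa0 ?mul0r ?mulr0.
  rewrite big_mkcond (bigD1_seq a) //= eqxx mulr1 big1 ?addr0; last first.
    by move=> b /negbTE ->; rewrite mulr0 if_same.
  by case: (E a).
have If' : I (f - f').
  apply/IE/allP => a; rewrite mcoeff_msupp mcoeffB f'E.
  by case: (E a) => //; rewrite subrr eqxx.
have f'0 : f' != 0.
  apply/eqP => f'0; apply: NP1; apply/Pf; rewrite mul1r.
  by move: If'; rewrite f'0 subr0.
pose c := mlead f'.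
have := mlead_supp f'0; rewrite mcoeff_msupp f'E -/c.
have [|NEc fc0] := boolP (E c); first by rewrite eqxx.
have Ewc : E (w + c)%MM.
  have Igf' : I (g * f').
    have -> : g * f' = g * f + (- g) * (f - f') by rewrite mulNr mulrBr; ring.
    case: Iideal => _ ID IM; apply: ID; [exact/Pf | exact: IM].
  move/IE: Igf' => /allP; apply; rewrite -mleadM // mlead_supp //.
  by rewrite mulf_neq0.
apply: leq_trans f_le; rewrite mulrC.
have /permP -> := msuppMX f w; rewrite count_map.
have /permP cf : perm_eq (msupp f) (c :: rem c (msupp f)).
  by apply: perm_to_rem; rewrite mcoeff_msupp.
rewrite !cf /= Ewc NEc add0n add1n ltnS sub_count // => b /=.
by apply: contra => Eb; rewrite Eup.
Qed.

Lemma annihilator_monomial P f g a : is_ideal I -> is_prime_ideal P ->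
    (forall h, P h <-> I (h * f)) -> P g -> a \in msupp g -> P 'X_[a].
Proof.
move=> Iideal Pprime Pf; have [k] := ubnP (size (msupp g)).
elim: k g => // k IHk g; rewrite ltnS => g_le Pg ag.
have g0 : g != 0 by apply: contraTneq ag => ->; rewrite msupp0.
have Pw := annihilator_mlead Iideal Pprime Pf Pg g0.
have [-> //|aw] := eqVneq a (mlead g).
have remE : msupp (g - g@_(mlead g) *: 'X_[mlead g]) =i rem (mlead g) (msupp g).
  exact/perm_mem/msupp_rem.
apply: (IHk (g - g@_(mlead g) *: 'X_[mlead g])).
- rewrite (perm_size (msupp_rem _ _)) size_rem ?mlead_supp //.
  by apply: leq_trans g_le; rewrite prednK // lt0n size_eq0 msupp_eq0.
- case: Pprime => [[P0 PD PM] _ _]; apply: PD => //.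
  by rewrite -scaleNr -mul_mpolyC; apply: PM.
- by rewrite remE mem_rem_uniq ?msupp_uniq // inE aw.
Qed.

End UpperBound.

(** * Heights of primes generated by variables *)

Section AlgebraicIndependence.

Variables (n : nat) (K : fieldType).
Implicit Types (P Q : {mpoly K[n]} -> Prop) (f g : {mpoly K[n]}).

Local Open Scope ring_scope.

Definition degree_le d f : Prop := forall a, a \in msupp f -> (mdeg a <= d)%N.

Lemma degree_leM d e f g :
  degree_le d f -> degree_le e g -> degree_le (d + e) (f * g).
Proof.
move=> fd ge a /msuppM_le /allpairsP [[b c] /= [/fd bd /ge ce ->]].
by rewrite mdegD leq_add.
Qed.

Lemma degree_leX d f m : degree_le d f -> degree_le (m * d) (f ^+ m).
Proof.
move=> fd; elim: m => [|m IHm].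
  by move=> a; rewrite expr0 -[1]/(1%:MP) msupp1 inE => /eqP ->; rewrite mdeg0.
by rewrite exprS mulSn; apply: degree_leM.
Qed.

Section Family.

Variables (k : nat) (y : 'I_k -> {mpoly K[n]}).
Implicit Types (F : {mpoly K[k]}) (B : {set 'I_k}).

Definition eval_at F : {mpoly K[n]} := F \mPo [tuple y i | i < k].

HB.instance Definition _ := GRing.RMorphism.copy eval_at
  (comp_mpoly [tuple y i | i < k]).

Lemma eval_atX a : eval_at 'X_[a] = \prod_i y i ^+ a i.
Proof.
by rewrite /eval_at comp_mpolyX; apply: eq_bigr => i _; rewrite tnth_mktuple.
Qed.

Lemma eval_atXU i : eval_at 'X_i = y i.
Proof. by rewrite /eval_at comp_mpolyXU -tnth_nth tnth_mktuple. Qed.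

Lemma eval_atZ c F : eval_at (c *: F) = c *: eval_at F.
Proof. exact: comp_mpolyZ. Qed.

(** Algebraic independence modulo Q of the y_i with i in B. Keeping one index
    type and varying B avoids changing the number of variables of F. *)
Definition alg_indep_mod Q B : Prop :=
  forall F, in_KZ B F -> Q (eval_at F) -> F = 0.

(** Write a relation as F = F0 + x_i F1 with F0 free of x_i. Modulo Q', where
    y_i vanishes, it reads F0(y) = 0, whence F0 = 0. Then y_i F1(y) is in Q, and
    so is F1(y), as Q is prime and y_i is not in Q; F1 has smaller degree in
    x_i. *)
Lemma alg_indep_mod_setU1 Q Q' B i :
    is_prime_ideal Q -> is_ideal Q' -> (forall f, Q f -> Q' f) ->
    Q' (y i) -> ~ Q (y i) -> alg_indep_mod Q' B ->
  alg_indep_mod Q (i |: B).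
Proof.
move=> [_ _ Qprime] Q'ideal QQ' Q'y NQy indB F.
have [d] : exists d, forall a, a \in msupp F -> (a i < d)%N.
  exists (\max_(a <- msupp F) a i).+1 => a aF.
  by rewrite ltnS (leq_bigmax_seq (F := fun a : 'X_{1..k} => a i)).
elim: d F => [|d IHd] F Fd FB QF.
  apply/eqP; rewrite -msupp_eq0.
  by case: (msupp F) Fd => // a s /(_ a (mem_head _ _)).
pose F0 := \sum_(a <- msupp F | a i == 0%N) F@_a *: 'X_[a].
pose F1 := \sum_(a <- msupp F | a i != 0%N) F@_a *: 'X_[a - U_(i)].
have FE : F = F0 + 'X_i * F1.
  rewrite [LHS]mpolyE (bigID (fun a : 'X_{1..k} => a i == 0%N)) /=.
  congr (_ + _).
  rewrite big_distrr /=; apply: eq_bigr => a ai.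
  by rewrite -scalerAr -mpolyXD addmC submK // lep1mP.
have evF : eval_at F = eval_at F0 + y i * eval_at F1.
  by rewrite FE rmorphD rmorphM /= eval_atXU.
have F00 : F0 = 0.
  apply: indB => [a /msupp_sum_le /flatten_mapP [b]|].
    rewrite mem_filter => /andP[bi bF] /msuppZ_le.
    rewrite msuppX inE => /eqP -> j jB.
    have [->|ji] := eqVneq j i; first exact/eqP.
    by apply: (FB b bF); rewrite !inE negb_or ji.
  have -> : eval_at F0 = eval_at F + (- eval_at F1) * y i by rewrite evF; ring.
  by case: Q'ideal => _ Q'D Q'M; apply: Q'D; [apply: QQ' | apply: Q'M].
suff F10 : F1 = 0 by rewrite FE F00 F10 mulr0 addr0.
apply: IHd.
- move=> a /msupp_sum_le /flatten_mapP [b].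
  rewrite mem_filter => /andP[bi bF] /msuppZ_le; rewrite msuppX inE => /eqP ->.
  by rewrite mnmBE mnm1E eqxx; have := Fd b bF; move: bi; lia.
- move=> a /msupp_sum_le /flatten_mapP [b].
  rewrite mem_filter => /andP[bi bF] /msuppZ_le.
  rewrite msuppX inE => /eqP -> j jB.
  by rewrite mnmBE (FB b bF).
- by move: QF; rewrite evF F00 rmorph0 add0r => /Qprime [].
Qed.

Lemma degree_le_eval_atX d e (a : 'X_{1..k}) : (forall i, degree_le d (y i)) ->
  (forall i, a i <= e)%N -> degree_le (k * (e * d)) (eval_at 'X_[a]).
Proof.
move=> yd ae; rewrite eval_atX.
have -> : (k * (e * d) = \sum_(i < k) e * d)%N.
  by rewrite sum_nat_const card_ord.
elim/big_rec2 : _ => [|i m f _ IH].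
  by move=> b; rewrite -[1]/(1%:MP) msupp1 inE => /eqP ->; rewrite mdeg0.
apply: degree_leM => // b bi; apply: leq_trans (degree_leX (yd i) bi) _.
by rewrite leq_mul2r ae orbT.
Qed.

(** The M^|B| monomials in the y_i, i in B, with exponents less than M have
    degree at most D = k M d, where d bounds the degrees of the y_i; so they lie
    in a space of dimension at most (D + 1)^n, which is less than M^(n+1) for M
    large. If |B| > n, some nontrivial linear combination of them vanishes. *)
Lemma alg_indep_card Q B : Q 0 -> alg_indep_mod Q B -> (#|B| <= n)%N.
Proof.
move=> Q0 indB; rewrite leqNgt; apply/negP => nB.
pose d := (\max_i msize (y i))%N.
have yd i : degree_le d (y i).
  move=> a ai; apply: ltnW; apply: leq_trans (msize_mdeg_lt ai) _.
  exact: (leq_bigmax_cond (F := fun i => msize (y i))).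
(* D + 1 <= c M, and M is chosen so that (c M)^n < M^(n + 1). *)
pose c := (k * d).+1; pose M := (c ^ n).+1; pose D := (k * (M * d))%N.
pose src := {ffun {i : 'I_k | i \in B} -> 'I_M}.
pose tgt := {ffun 'I_n -> 'I_D.+1}.
have card_lt : (#|{: tgt}| < #|{: src}|)%N.
  rewrite !card_ffun !card_ord card_sig.
  have -> : #|[pred i | i \in B]| = #|B| by apply: eq_card.
  apply: (@leq_trans (M ^ n.+1)); last by rewrite leq_exp2l // ltnS expn_gt0.
  rewrite expnS -[M in (M * _)%N]/((c ^ n).+1) mulSn.
  apply: (@leq_ltn_trans (c ^ n * M ^ n)).
    rewrite -expnMn; have [->//|n0] := posnP n; rewrite leq_exp2r //.
    by rewrite /D mulnCA mulnC mulSn -[ltnLHS]add0n -addSn leq_add.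
  by rewrite -[ltnLHS]add0n ltn_add2r expn_gt0.
pose mon (phi : src) : 'X_{1..k} :=
  [multinom if insub i is Some s then phi s : nat else 0%N | i < k].
have mon_inj : injective mon.
  move=> phi psi /mnmP e; apply/ffunP => s; apply/val_inj.
  by have := e (val s); rewrite !mnmE valK.
pose tmon (psi : tgt) : 'X_{1..n} := [multinom (psi i : nat) | i < n].
pose A : 'M[K]_(#|{: src}|, #|{: tgt}|) :=
  \matrix_(r, s) (eval_at 'X_[mon (enum_val r)])@_(tmon (enum_val s)).
have [r Ar] : exists2 r : 'rV_#|{: src}|, r != 0 & r *m A = 0.
  have : kermx A != 0.
    rewrite -mxrank_eq0 mxrank_ker subn_eq0 -ltnNge.
    exact: leq_ltn_trans (rank_leq_col A) card_lt.
  by case/rowV0Pn => r /sub_kermxP rA r0; exists r.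
move=> rA0.
pose F := \sum_r' r 0 r' *: 'X_[mon (enum_val r')].
have F0 : F = 0.
  apply: indB.
    move=> a /(msupp_sum_le (P := predT)) /flatten_mapP [s _] /msuppZ_le.
    by rewrite msuppX inE => /eqP -> i iB; rewrite mnmE insubN.
  suff -> : eval_at F = 0 by [].
  apply/mpolyP => b; rewrite mcoeff0 rmorph_sum raddf_sum /=.
  have [bD|bD] := leqP (mdeg b) D; last first.
    rewrite big1 // => s _; rewrite eval_atZ mcoeffZ memN_msupp_eq0 ?mulr0 //.
    apply: contraL bD => bs; rewrite -leqNgt.
    apply: (degree_le_eval_atX yd) bs => i; rewrite mnmE.
    by case: insub => // t; apply: ltnW.
  have bi i : (b i < D.+1)%N.
    by apply: leq_trans bD; rewrite mdegE (bigD1 i) //= leq_addr.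
  have /matrixP /(_ 0 (enum_rank ([ffun i => Ordinal (bi i)] : tgt))) := rA0.
  rewrite !mxE => sum0; rewrite -[RHS]sum0; apply: eq_bigr => s _.
  rewrite eval_atZ mcoeffZ mxE enum_rankK; congr (_ * _@__).
  by apply/mnmP => i; rewrite mnmE ffunE.
case/eqP: Ar; apply/rowP => s; rewrite mxE.
have := congr1 (mcoeff (mon (enum_val s))) F0; rewrite mcoeff0 raddf_sum /=.
rewrite (bigD1 s) //= mcoeffZ mcoeffX eqxx mulr1 big1 ?addr0 // => t ts.
rewrite mcoeffZ mcoeffX (inj_eq mon_inj) (inj_eq enum_val_inj) (negbTE ts).
by rewrite mulr0.
Qed.

End Family.

Lemma prime_monomial P a : is_prime_ideal P -> P 'X_[a] ->
  exists2 i, P 'X_i & a i != 0%N.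
Proof.
move=> [_ NP1 Pprime]; have [k] := ubnP (mdeg a); elim: k a => // k IHk a.
rewrite ltnS => ak Pa; have [a0|] := boolP [forall i, a i == 0%N].
  case: NP1; rewrite -[1](mpolyX0 n K); suff <- : a = 0%MM by [].
  by apply/mnmP => i; rewrite mnm0E (eqP (forallP a0 i)).
case/forallPn => i ai; have iLa : (U_(i) <= a)%MM by rewrite lep1mP.
have : P ('X_[a - U_(i)] * 'X_i) by rewrite -mpolyXD submK.
case/Pprime => [|Pi]; last by exists i.
move=> /IHk [|j Pj aj].
  by apply: leq_trans ak; rewrite -[in ltnRHS](submK iLa) mdegD mdeg1 addn1.
by exists j => //; apply: contra aj; rewrite mnmBE => /eqP ->.
Qed.

(** The family y consists of the variables and of one element f_j of each
    difference of consecutive primes of the chain. Modulo Q_j the variables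
    outside V together with the f_j' for j' >= j are independent: for j = h,
    since every monomial of P involves a variable of V, and then downwards along
    the chain. For j = 0 these are n - |V| + h polynomials in n variables. *)
Lemma prime_chain_monomial P (V : {set 'I_n}) h
    (Q : nat -> {mpoly K[n]} -> Prop) :
    is_prime_ideal P -> (forall g a, P g -> a \in msupp g -> P 'X_[a]) ->
    (forall i, i \in V <-> P 'X_i) -> prime_chain P h Q ->
  (h <= #|V|)%N.
Proof.
move=> Pprime Pmon VP [Qprime Qstrict QP].
have [f fP] : exists f : 'I_h -> {mpoly K[n]},
    forall j : 'I_h, Q j.+1 (f j) /\ ~ Q j (f j).
  apply: (fin_all_exists (P := fun (j : 'I_h) f => Q j.+1 f /\ ~ Q j f)) => j.
  by have [_ [f]] := Qstrict j (ltn_ord j); exists f.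
pose y (i : 'I_(n + h)) := match split i with inl i => 'X_i | inr j => f j end.
pose B j := [set i : 'I_(n + h) | match split i with
               | inl i => i \notin V | inr j' => j <= j' end]%N.
have indB j : (j <= h)%N -> alg_indep_mod y (Q (h - j)%N) (B (h - j)%N).
  elim: j => [_|j IHj jh].
    rewrite subn0 => F FB QF; apply/eqP; rewrite -msupp_eq0.
    case FE : (msupp F) => [//|a s]; exfalso.
    have aF : a \in msupp F by rewrite FE mem_head.
    pose low (b : 'X_{1..n + h}) : 'X_{1..n} :=
      [multinom b (lshift h i) | i < n].
    have evX b : b \in msupp F -> eval_at y 'X_[b] = 'X_[low b].
      move=> bF; rewrite eval_atX big_split_ord /= [X in _ * X]big1 ?mulr1.
        rewrite mpolyXE_id; apply: eq_bigr => i _.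
        by rewrite mnmE /y (unsplitK (inl i)).
      move=> i _; rewrite (FB b bF) // inE (unsplitK (inr i)) -ltnNge.
      exact: ltn_ord.
    have low_inj b : b \in msupp F -> low b = low a -> b = a.
      move=> bF /mnmP e; apply/mnmP => i; have [j ->|j ->] := split_ordP i.
        by have := e j; rewrite !mnmE.
      by rewrite (FB b bF) ?(FB a aF) // inE (unsplitK (inr j)) -ltnNge ltn_ord.
    have low_a : low a \in msupp (eval_at y F).
      rewrite mcoeff_msupp [F]mpolyE rmorph_sum raddf_sum /=.
      rewrite (bigD1_seq a) ?msupp_uniq //= eval_atZ mcoeffZ evX // mcoeffX.
      rewrite eqxx mulr1 big1_seq ?addr0 -?mcoeff_msupp // => b /andP[ba bF].
      rewrite eval_atZ mcoeffZ evX // mcoeffX (_ : _ == _ = false) ?mulr0 //.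
      by apply: contraNF ba => /eqP /low_inj ->.
    have [i Pi] := prime_monomial Pprime (Pmon _ _ ((QP _).1 QF) low_a).
    rewrite mnmE (FB a aF) // inE (unsplitK (inl i)) negbK.
    exact/VP.
  have jlt : (h - j.+1 < h)%N by lia.
  pose o := Ordinal jlt; pose i := rshift n o.
  have SjE : (h - j.+1).+1 = (h - j)%N by lia.
  have -> : B (h - j.+1)%N = i |: B (h - j)%N.
    apply/setP => i'; rewrite !inE; have [j' ->|j' ->] := split_ordP i'.
      by rewrite eq_lrshift.
    by rewrite -SjE eq_rshift leq_eqVlt eq_sym.
  have yi : y i = f o by rewrite /y (unsplitK (inr o)).
  have [Q1f NQf] := fP o; rewrite /= SjE in Q1f.
  have [QQ' _] := Qstrict _ jlt; rewrite SjE in QQ'.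
  apply: (alg_indep_mod_setU1 (Q' := Q (h - j)%N)); rewrite ?yi //.
  - by apply: Qprime; lia.
  - by have [] := Qprime (h - j)%N (leq_subr _ _).
  - by apply: IHj; lia.
have Q00 : Q 0%N 0 by have [[]] := Qprime 0%N isT.
have := indB h (leqnn h); rewrite subnn => /(alg_indep_card Q00).
have -> : B 0%N = (@lshift n h @: ~: V) :|: (@rshift n h @: setT).
  apply/setP => i; rewrite !inE; have [j ->|j ->] := split_ordP i.
    rewrite (mem_imset _ _ (@lshift_inj _ _)) inE.
    case: imsetP => [[j' _ /eqP]|]; last by rewrite orbF.
    by rewrite eq_lrshift.
  by rewrite (mem_imset _ _ (@rshift_inj _ _)) inE orbT.
rewrite cardsU (_ : _ :&: _ = set0) ?cards0 ?subn0; last first.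
  apply/setP => i; rewrite !inE; apply/negP => /andP[/imsetP[j _ ->]].
  by case/imsetP => j' _ /eqP; rewrite eq_lrshift.
rewrite !card_imset; [|exact: rshift_inj|exact: lshift_inj].
rewrite cardsT card_ord => le_n; rewrite -(leq_add2l #|~: V|).
by rewrite (leq_trans le_n) // addnC cardsC card_ord.
Qed.

End AlgebraicIndependence.

(** * The Stanley depth *)

(** Repeating a generator changes neither the ideal nor, the number of
    generators being even, the integer part of half of that number. *)
Lemma sdepth_lower_bound (K : fieldType) (n : nat) (I : {mpoly K[n]} -> Prop)
    (s : seq 'X_{1..n}) : ~~ odd (size s) ->
    (forall f, I f <-> all (fun a => has (fun b => (b <= a)%MM) s) (msupp f)) ->
  exists2 D, stanley_decomp I D & n - (size s)./2 <= sdepth_decomp D.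
Proof.
move=> even_s Is; have le_n := leq_subr (size s)./2 n.
case: s even_s Is le_n => [|b s] even_s Is le_n.
  by apply: (stanley_decomp_of_boxes Is) le_n; apply: box_partition0.
apply: (stanley_decomp_of_boxes Is) le_n.
have sz : (size (b :: b :: s))./2 = (size (b :: s))./2.
  by move: even_s; rewrite /= uphalf_half => /negPn ->.
rewrite -sz.
have := @box_partition_monomial_ideal n _
  (tnth (in_tuple (b :: b :: s))) even_s.
apply: box_partition_eq => a.
transitivity (has (fun c => (c <= a)%MM) (b :: b :: s)).
  apply/existsP/hasP => [[j ja]|[c]].
    by exists (tnth (in_tuple (b :: b :: s)) j) => //; apply: mem_tnth.
  by case/(tnthP (in_tuple (b :: b :: s))) => j -> ja; exists j.
by rewrite /= orbA orbb.
Qed.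

Theorem corollary1p3 (K : fieldType) (n m : nat) (I : {mpoly K[n]} -> Prop)
  (hI : is_monomial_ideal I)
  (hG : has_card (min_gens I) m)
  (hm : ~~ odd m)
  (hP : exists P : {mpoly K[n]} -> Prop, assoc_prime I P /\ has_height P m) :
  has_sdepth I (n - m %/ 2).
Proof.
have Iideal := monomial_ideal_is_ideal hI.
have [s sz_s Is] := monomial_ideal_gens hI hG.
have [P [[Pprime [f Pf]] [[Q chain] _]]] := hP.
have lower := sdepth_lower_bound _ Is; rewrite sz_s in lower.
rewrite divn2; suff upper D : stanley_decomp I D -> sdepth_decomp D <= n - m./2.
  split=> //; have [D stD leD] := lower hm; exists D => //.
  by apply/eqP; rewrite eqn_leq upper.
(* For m = 0 the ideal is zero, with depth n by convention. *)
move=> stD; have [->|m_gt0] := posnP m.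
  by rewrite subn0 sdepth_decomp_le_n.
set E := (fun a => has _ s) in Is.
pose V := [set i : 'I_n | all E (msupp ('X_i * f)%R)].
have VP i : i \in V <-> P ('X_i)%R by rewrite inE Pf Is.
have Pmon g a : P g -> a \in msupp g -> P ('X_[a])%R.
  exact: (annihilator_monomial Is Iideal Pprime Pf).
have mV : m <= #|V| := prime_chain_monomial Pprime Pmon VP chain.
have /allPn [a af NEa] : ~~ all E (msupp f).
  by apply/negP => /Is If; case: Pprime => _ NP1 _; apply/NP1/Pf; rewrite mul1r.
have NIa : ~ I ('X_[a])%R.
  by move=> /Is; rewrite msuppX /= andbT (negbTE NEa).
have IaV : {in V, forall i, I ('X_[a + U_(i)])%R}.
  move=> i /VP/Pf/(monomial_ideal_msupp _ hI); apply.
  rewrite mulrC (perm_mem (msuppMX _ _)).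
  by apply/mapP; exists a; rewrite // addmC.
have V0 : V != set0 by rewrite -card_gt0; apply: leq_trans mV.
move: (sdepth_upper_bound Iideal stD NIa IaV V0) mV.
move: #|V| (sdepth_decomp D) => v d.
by rewrite -{1}(even_halfK hm) -!addnn; lia.
Qed.
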